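(* Let $m\ge 2$, $n\ge 1$ be integers and let $\mathcal{A}\in\mathbb{T}_{m,n}$. If $\mathcal{A}$ is a P-tensor, then $\mathcal{A}$ is a ${\rm Z}^+$-tensor.
   Context: $\mathbb{T}_{m,n}$ denotes the set of all $m$-th order $n$-dimensional square real tensors $\mathcal{A}=(a_{i_1i_2\cdots i_m})$, $i_1,\ldots,i_m\in\{1,\ldots,n\}$. For $\mathcal{A}\in\mathbb{T}_{m,n}$ and $x\in\mathbb{R}^n$, $\mathcal{A}x^{m-1}\in\mathbb{R}^n$ is the vector with components $(\mathcal{A}x^{m-1})_i=\sum_{i_2,\ldots,i_m=1}^n a_{ii_2\cdots i_m}x_{i_2}\cdots x_{i_m}$, $i=1,\ldots,n$. A tensor $\mathcal{A}\in\mathbb{T}_{m,n}$ is a P-tensor if $\max_{1\le i\le n}x_i(\mathcal{A}x^{m-1})_i>0$ for every $x\in\mathbb{R}^n\setminus\{0\}$. A tensor $\mathcal{A}\in\mathbb{T}_{m,n}$ is a ${\rm Z}^+$-tensor if there exists no pair $(x,t)\in(\mathbb{R}^n\setminus\{0\})\times\mathbb{R}_+$ (with $\mathbb{R}_+=[0,\infty)$) such that $\mathcal{A}x^{m-1}+tx=0$. *)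

(* Defs.v *)
From mathcomp Require Import all_boot all_order all_algebra.
From mathcomp Require Import reals constructive_ereal.

Set Implicit Arguments.
Unset Strict Implicit.
Unset Printing Implicit Defensive.

Import Order.TTheory GRing.Theory Num.Theory.
Local Open Scope ring_scope.

Definition tensor (R : realType) (m n : nat) : Type :=
  {ffun m.-tuple 'I_n -> R}.

(* [tensor_apply A x] is A x^(m-1).  Its i-th component sums over the index
   tuples t = (i_1, i_2, ..., i_m) with i_1 = i, and [behead t] is
   (i_2, ..., i_m); filtering on the head avoids casting between
   [m.-tuple] and [(m.-1).+1.-tuple].  It is meaningful for m >= 1. *)
Definition tensor_apply (R : realType) (m n : nat) (A : tensor R m n)
    (x : 'cV[R]_n) : 'cV[R]_n :=
  \col_(i < n) \sum_(t : m.-tuple 'I_n | ohead t == Some i)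
     A t * \prod_(j <- behead t) x j 0.

(* The maximum is computed in the extended reals because -oo is a neutral
   element for it; for n >= 1 it is the usual maximum of n real numbers. *)
Definition P_tensor (R : realType) (m n : nat) (A : tensor R m n) : Prop :=
  forall x : 'cV[R]_n, x != 0 ->
    (0 < \big[maxe/-oo]_(i < n) (x i 0 * tensor_apply A x i 0)%:E)%E.

Definition Zplus_tensor (R : realType) (m n : nat) (A : tensor R m n) : Prop :=
  ~ exists (x : 'cV[R]_n) (t : R),
      [/\ x != 0, 0 <= t & tensor_apply A x + t *: x = 0].

(* Main.v *)
Require Import Defs.
From mathcomp Require Import all_boot all_order all_algebra.
From mathcomp Require Import reals constructive_ereal.

Import Order.TTheory GRing.Theory Num.Theory.

(** If [tensor_apply A x = - t *: x] with [0 <= t], multiplying entry [i] by [x i 0] gives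
    [- t * x i 0 ^+ 2 <= 0]. So the maximum in [P_tensor] is at most [0], against its positivity at
    [x != 0]. *)

Theorem proposition2p1 (R : realType) (m n : nat) (hm : (2 <= m)%N)
  (hn : (1 <= n)%N) (A : tensor R m n) (hA : P_tensor A) : Zplus_tensor A.
Proof.
move=> [x [t [x0 t0 Axt]]].
have := hA x x0; rewrite ltNge => /negP; apply.
apply: (big_ind (fun a => (a <= 0)%E)) => [|a b a0 b0|i _]; first exact: leNye.
  by rewrite ge_max a0 b0.
have /eqP := congr1 (fun v : 'cV[R]_n => v i ord0) Axt.
(* The patterns aim [mxE] at the entries of [t *: x] and [0], so that the entry of
   [tensor_apply A x] stays folded. *)
rewrite mxE [X in (_ + X)%R]mxE [X in _ == X]mxE addr_eq0 => /eqP Axi.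
rewrite lee_fin Axi mulrN oppr_le0 mulrCA mulr_ge0 //.
exact: sqr_ge0.
Qed.
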